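(* Let $0<q<1$ and let $n\ge 1$ be an integer. The zeros of the q-Meixner polynomial $M_n^{(\alpha,\beta)}(\cdot;q)$ ($\alpha>0$, $0\le\beta<q^{-1}$) are strictly increasing functions of $\alpha$ on $(0,\infty)$ (for fixed $\beta$) and strictly decreasing functions of $\beta$ on $[0,q^{-1})$ (for fixed $\alpha$).
   Context: The q-Meixner polynomial is the polynomial of degree $n$ in $X$ (with $X=x(s)=q^{-s}$) given by $$M_n^{(\alpha,\beta)}(X;q)={}_2\phi_1\left(\left.{q^{-n},\,X\atop \beta q}\right|q,-\frac{q^{n+1}}{\alpha}\right)=\sum_{k=0}^n\frac{(q^{-n};q)_k(X;q)_k}{(\beta q;q)_k(q;q)_k}\left(-\frac{q^{n+1}}{\alpha}\right)^k,$$ where $(u;q)_k=\prod_{j=0}^{k-1}(1-uq^j)$. Zeros are zeros in the variable $X$; there are $n$ of them, real and distinct, lying in $(1,\infty)$. The statement refers to each zero (the zeros being arranged in increasing order) as a function of the parameter. *)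

(* Defs.v *)
From mathcomp Require Import all_boot all_order all_algebra.
From mathcomp Require Import reals.
From mathcomp Require Import polyrcf.

Set Implicit Arguments.
Unset Strict Implicit.
Unset Printing Implicit Defensive.

Import Order.TTheory GRing.Theory Num.Theory.
Local Open Scope ring_scope.

(* (u; q)_k, over any ring: it is used both with u, q scalars and, for the
   factor (X; q)_k, with u := 'X and q%:P in the polynomial ring. *)
Definition qpoch (A : nzRingType) (u q : A) (k : nat) : A :=
  \prod_(j < k) (1 - u * q ^+ j).

(* The q-Meixner polynomial as a polynomial in X = q^{-s}; the terminating
   series 2phi1(q^{-n}, X; beta q; q, - q^{n+1} / alpha) is the sum of its
   terms of index 0, ..., n. *)
Definition qMeixner (R : fieldType) (q : R) (n : nat) (alpha beta : R) :
    {poly R} :=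
  \sum_(k < n.+1)
    (qpoch (q ^- n) q k / (qpoch (beta * q) q k * qpoch q q k)
       * (- (q ^+ n.+1 / alpha)) ^+ k) *: qpoch 'X q%:P k.

(* The k-th zero (k = 0, ..., n - 1) in increasing order: rootsR p is the
   strictly increasing list of all the real roots of p.  A missing zero would
   read as the default value 0. *)
Definition qMeixner_zero (R : rcfType) (q : R) (n : nat) (alpha beta : R)
    (k : nat) : R :=
  (rootsR (qMeixner q n alpha beta))`_k.

(* Main.v *)
(* Put a := alpha and b := beta.  The polynomials M_n at (a, b) and M_(n-1) at
   (a / q, b q) are linked by the first-order q-difference relation
     (1 - b q) X M_n(X) = (X - b q) M_(n-1)(X)
                          - q (X - 1) (X / a + b) M_(n-1)(q X).
   By induction the zeros z_0 < z_1 < ... of M_(n-1) are > 1 and satisfy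
   z_j < q z_(j+1); the signs of M_n at 1, at the z_j and z_j / q, and at
   infinity then put exactly one zero of M_n in each interval
   ]z_(i-1) / q, z_i[, and these zeros are again > 1 and q-separated.
   On that interval the zero of M_n solves
     \prod_j (X - z_j) / (q X - z_j) = q (X - 1) (X / a + b) / (X - b q),
   where the left-hand side minus the right-hand side changes sign from + to -,
   the left-hand side increases with each z_j, and the right-hand side strictly
   increases with 1 / a and b.  So if the z_j move down when 1 / a or b grows,
   so do the zeros of M_n, strictly. *)
Require Import Defs.
From mathcomp Require Import all_boot all_order all_algebra.
From mathcomp Require Import reals polyrcf ring.

Import Order.TTheory GRing.Theory Num.Theory.
Local Open Scope ring_scope.

(** * q-Pochhammer symbols and evaluation of the polynomial *)

Lemma qpochSr {A : nzRingType} (u q : A) k :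
  qpoch u q k.+1 = qpoch u q k * (1 - u * q ^+ k).
Proof. by rewrite /qpoch big_ord_recr. Qed.

Lemma qpochSl {A : nzRingType} (u q : A) k :
  qpoch u q k.+1 = (1 - u) * qpoch (u * q) q k.
Proof.
rewrite /qpoch big_ord_recl expr0 mulr1; congr (_ * _).
by apply: eq_bigr => j _; rewrite -mulrA -exprS.
Qed.

Lemma horner_qpochX {R : comNzRingType} (q x : R) k :
  (qpoch 'X q%:P k).[x] = qpoch x q k.
Proof.
rewrite horner_prod; apply: eq_bigr => j _.
by rewrite -polyC_exp hornerD hornerN hornerM hornerX !hornerC.
Qed.

Definition qMeixner_coef {R : fieldType} (q : R) n (alpha beta : R) k :=
  qpoch (q ^- n) q k / (qpoch (beta * q) q k * qpoch q q k)
    * (- (q ^+ n.+1 / alpha)) ^+ k.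

Lemma horner_qMeixner {R : fieldType} (q : R) n alpha beta x :
  (qMeixner q n alpha beta).[x] =
  \sum_(k < n.+1) qMeixner_coef q n alpha beta k * qpoch x q k.
Proof.
by rewrite horner_sum; apply: eq_bigr => k _; rewrite hornerZ horner_qpochX.
Qed.

Section QMeixner.
Set Implicit Arguments.
Unset Strict Implicit.
Variables (R : rcfType) (q : R).
Hypotheses (q_gt0 : 0 < q) (q_lt1 : q < 1).

(** * Coefficients and the first-order q-difference relation *)

Definition admissible (alpha beta : R) := [&& 0 < alpha, 0 <= beta & beta * q < 1].

Lemma admissible_shift alpha beta :
  admissible alpha beta -> admissible (alpha / q) (beta * q).
Proof.
case/and3P=> a0 b0 b1; apply/and3P; split; first exact: divr_gt0.
  by rewrite mulr_ge0 // ltW.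
rewrite (le_lt_trans _ b1) // ler_piMr ?(ltW q_lt1) // mulr_ge0 // ltW //.
Qed.

Lemma qpoch_gt0 u k : 0 <= u -> u < 1 -> 0 < qpoch u q k.
Proof.
move=> u0 u1; apply: prodr_gt0 => j _.
by rewrite subr_gt0 (le_lt_trans _ u1) // ler_piMr // exprn_ile1 ?ltW.
Qed.

(** Coefficient form of [qMeixner_rec]. Both sides carry powers of the same number -(q^(n+2) /
    alpha), and all symbols reduce to common ones of length k, for instance (q^(-n-1); q)_(k+1) = (1
    - q^(-n-1)) (q^(-n); q)_k; a rational identity remains. *)
Lemma qMeixner_coefS n alpha beta k : admissible alpha beta ->
  (1 - beta * q) * qMeixner_coef q n.+1 alpha beta k.+1 =
  (1 - beta * q ^+ k.+2) * qMeixner_coef q n (alpha / q) (beta * q) k.+1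
  + q / alpha * qMeixner_coef q n (alpha / q) (beta * q) k.
Proof.
move=> adm; have /and3P[a0 b0 b1] := adm; rewrite /qMeixner_coef.
have -> : q ^+ n.+1 / (alpha / q) = q ^+ n.+2 / alpha.
  by rewrite invf_div mulrA -exprSr.
have qn0 : q ^+ n != 0 by rewrite expf_neq0 ?lt0r_neq0.
have -> : qpoch (q ^- n.+1) q k.+1 = (1 - q ^- n.+1) * qpoch (q ^- n) q k.
  rewrite qpochSl; congr (_ * qpoch _ _ _).
  by rewrite exprS invfM mulrAC mulVf ?lt0r_neq0 ?mul1r.
have : qpoch (beta * q * q) q k.+1 != 0.
  have /and3P[_ ? b2] := admissible_shift adm.
  by rewrite gt_eqF // qpoch_gt0 // mulr_ge0 // ltW.
have : qpoch q q k.+1 != 0 by rewrite gt_eqF // qpoch_gt0 // ltW.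
rewrite (qpochSl (beta * q)) !qpochSr !mulf_eq0 !negb_or [_ ^+ k.+1]exprS.
rewrite [q ^+ k.+2]exprS [q ^+ k.+1]exprS [q ^+ n.+2]exprS [q ^+ n.+1]exprS.
move: (qpoch _ _ _) (qpoch _ _ _) (qpoch _ _ _) ((- _) ^+ k) => A B C Y.
move: (q ^+ k) => t.
move=> /andP[C1 C2] /andP[B1 B2].
have b3 : 1 - beta * q != 0 by rewrite subr_eq0 gt_eqF.
by field; rewrite C1 B1 C2 B2 qn0 b3 !lt0r_neq0.
Qed.

Lemma qMeixner_coef0 n alpha beta : qMeixner_coef q n alpha beta 0 = 1.
Proof. by rewrite /qMeixner_coef /qpoch !big_ord0 expr0 !mulr1 divr1. Qed.

(** The last factor of (q^(-n); q)_(n+1) is 1 - q^(-n) q^n = 0. Sums up to n can thus be lengthened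
    by one term. *)
Lemma qMeixner_coef_last n alpha beta : qMeixner_coef q n alpha beta n.+1 = 0.
Proof.
rewrite /qMeixner_coef qpochSr mulVf ?subrr ?mulr0 ?mul0r //.
by rewrite expf_neq0 ?lt0r_neq0.
Qed.

(* Follows from [(1 - x) (q x; q)_k = (x; q)_(k+1) = (1 - x q^k) (x; q)_k],
   which turns the right-hand side into
   [x \sum_k c_k ((1 - beta q^(k+1)) (x; q)_k + q / alpha (x; q)_(k+1))]. *)
Lemma qMeixner_rec n alpha beta x : admissible alpha beta ->
  (1 - beta * q) * x * (qMeixner q n.+1 alpha beta).[x] =
  (x - beta * q) * (qMeixner q n (alpha / q) (beta * q)).[x]
  - q * (x - 1) * (x / alpha + beta)
    * (qMeixner q n (alpha / q) (beta * q)).[q * x].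
Proof.
move=> adm; rewrite !horner_qMeixner.
set c := qMeixner_coef q n _ _.
have -> : (x - beta * q) * (\sum_(k < n.+1) c k * qpoch x q k)
   - q * (x - 1) * (x / alpha + beta) * (\sum_(k < n.+1) c k * qpoch (q * x) q k)
  = x * (\sum_(k < n.+1) c k * (1 - beta * q ^+ k.+1) * qpoch x q k
         + \sum_(k < n.+1) q / alpha * c k * qpoch x q k.+1).
  rewrite !mulr_sumr -sumrB -big_split mulr_sumr /=; apply: eq_bigr => k _.
  have Ex := qpochSl x q k; have Er := qpochSr x q k.
  rewrite [x * q]mulrC in Ex.
  transitivity ((x - beta * q) * (c k * qpoch x q k)
     + q * (x / alpha + beta) * (c k * ((1 - x) * qpoch (q * x) q k))).
    by ring.
  by rewrite -Ex Er exprS; ring.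
rewrite -mulrA [(1 - _) * _]mulrCA; congr (_ * _).
have -> : \sum_(k < n.+1) c k * (1 - beta * q ^+ k.+1) * qpoch x q k
  = \sum_(k < n.+2) c k * (1 - beta * q ^+ k.+1) * qpoch x q k.
  by rewrite [RHS]big_ord_recr /= /c qMeixner_coef_last !mul0r addr0.
rewrite mulr_sumr !(big_ord_recl n.+1) /= {1 2}/c !qMeixner_coef0 -addrA -big_split /=.
rewrite expr1 !mul1r; congr (_ + _); apply: eq_bigr => k _.
rewrite /bump /= !add1n mulrA qMeixner_coefS // mulrDl; congr (_ * _ + _).
exact: mulrC.
Qed.

(** * Value at 1, degree and sign of the leading coefficient *)

Lemma qMeixner_at1 n alpha beta : (qMeixner q n alpha beta).[1] = 1.
Proof.
rewrite horner_qMeixner big_ord_recl qMeixner_coef0 /qpoch big_ord0 mulr1.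
by rewrite big1 ?addr0 // => k _; rewrite big_ord_recl expr0 mulr1 subrr mul0r mulr0.
Qed.

(** Each factor 1 - X q^j is -q^j (X - q^(-j)); degree and leading coefficient are then read off. *)
Lemma qpochX_factor k : qpoch ('X : {poly R}) q%:P k =
  (\prod_(j < k) (- q ^+ j)) *: \prod_(j < k) ('X - (q ^- j)%:P).
Proof.
rewrite /qpoch -scaler_prod; apply: eq_bigr => j _.
have qj0 : q ^+ j != 0 by rewrite expf_neq0 ?lt0r_neq0.
by rewrite scaleNr scalerBr opprB scale_polyC divff // -polyC_exp mulrC mul_polyC.
Qed.

Lemma size_qpochX k : size (qpoch ('X : {poly R}) q%:P k) = k.+1.
Proof.
rewrite qpochX_factor size_scale; last first.
  by apply/prodf_neq0 => j _; rewrite oppr_eq0 expf_neq0 ?lt0r_neq0.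
rewrite -(big_mkord xpredT (fun j => 'X - (q ^- j)%:P)).
by rewrite size_prod_XsubC size_iota subn0.
Qed.

Lemma lead_coef_qpochX k :
  lead_coef (qpoch ('X : {poly R}) q%:P k) = \prod_(j < k) (- q ^+ j).
Proof. by rewrite qpochX_factor lead_coefZ lead_coef_prod_XsubC mulr1. Qed.

(** Each factor 1 - q^(j-n) with j < n is negative; pairing it with one of the n negative factors
    -(q^(n+1) / alpha) gives positive products. *)
Lemma qMeixner_coef_gt0 n alpha beta : admissible alpha beta ->
  0 < qMeixner_coef q n alpha beta n.
Proof.
case/and3P=> a0 b0 b1; rewrite /qMeixner_coef mulrAC.
apply: divr_gt0; last by rewrite mulr_gt0 // qpoch_gt0 // ?mulr_ge0 // ltW.
set y := - _; have -> : y ^+ n = \prod_(j < n) y by rewrite prodr_const card_ord.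
rewrite /qpoch -big_split /=.
apply: prodr_gt0 => j _; rewrite nmulr_rgt0.
  by rewrite /y oppr_lt0 divr_gt0 ?exprn_gt0.
rewrite subr_lt0 mulrC ltr_pdivlMr ?exprn_gt0 // mul1r.
by rewrite ltr_iXn2l.
Qed.

Lemma qMeixner_split n alpha beta : qMeixner q n alpha beta =
  (\sum_(k < n) qMeixner_coef q n alpha beta k *: qpoch 'X q%:P k)
  + qMeixner_coef q n alpha beta n *: qpoch 'X q%:P n.
Proof. by rewrite /qMeixner big_ord_recr. Qed.

Lemma size_qMeixner_tail n alpha beta : admissible alpha beta ->
  (size (\sum_(k < n) qMeixner_coef q n alpha beta k *: qpoch 'X q%:P k)%R
   < size (qMeixner_coef q n alpha beta n *: qpoch ('X : {poly R}) q%:P n)%R)%N.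
Proof.
move=> adm; rewrite size_scale ?gt_eqF ?qMeixner_coef_gt0 // size_qpochX ltnS.
apply: (leq_trans (size_sum _ _ _)); apply/bigmax_leqP => k _.
by apply: (leq_trans (size_scale_leq _ _)); rewrite size_qpochX.
Qed.

Lemma size_qMeixner n alpha beta : admissible alpha beta ->
  size (qMeixner q n alpha beta) = n.+1.
Proof.
move=> adm; rewrite qMeixner_split addrC size_polyDl ?size_qMeixner_tail //.
by rewrite size_scale ?gt_eqF ?qMeixner_coef_gt0 // size_qpochX.
Qed.

(** Only the term of index n reaches degree n: its coefficient is positive and (X; q)_n has leading
    coefficient \prod_j (- q^j). *)
Lemma lead_coef_qMeixner n alpha beta : admissible alpha beta ->
  0 < (-1) ^+ n * lead_coef (qMeixner q n alpha beta).
Proof.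
move=> adm; rewrite qMeixner_split lead_coefDr ?size_qMeixner_tail //.
rewrite lead_coefZ lead_coef_qpochX mulrCA mulr_gt0 ?qMeixner_coef_gt0 //.
rewrite prodrN card_ord signrMK.
by apply: prodr_gt0 => j _; rewrite exprn_gt0.
Qed.

(** * q-separated sequences and the gaps between their terms *)

Definition separated (z : nat -> R) n :=
  (forall j, (j < n)%N -> 1 < z j) /\
  (forall j, (j.+1 < n)%N -> z j < q * z j.+1).

Lemma separated_homo z n j k : separated z n -> (j < k < n)%N -> z j < z k.
Proof.
case=> z_gt1 zsep; elim: k => // k IHk /andP[jk kn].
have zkk : z k < z k.+1.
  rewrite (lt_trans (zsep k kn)) // gtr_pMl // (lt_trans ltr01) //.
  exact: z_gt1.
move: jk; rewrite ltnS leq_eqVlt => /predU1P[-> //|jk].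
by rewrite (lt_trans _ zkk) // IHk // jk ltnW.
Qed.

(** The implications drop the lower bound when i = 0 and the upper bound when i = n, so the two
    unbounded gaps need no separate treatment. *)
Definition in_gap (z : nat -> R) n i x :=
  (forall j, i = j.+1 -> z j < x) /\ ((i < n)%N -> x < z i).

Lemma in_gap_lt z n i x j : separated z n -> (i <= n)%N -> in_gap z n i x ->
  (j < i)%N -> z j < x.
Proof.
case: i => // i zsep ilen [zx _]; rewrite ltnS leq_eqVlt => /predU1P[->|ji].
  exact: zx.
by rewrite (lt_trans _ (zx i _)) // (separated_homo zsep) // ji.
Qed.

Lemma in_gap_gt z n i x j : separated z n -> in_gap z n i x ->
  (i <= j < n)%N -> x < z j.
Proof.
move=> zsep [_ xz] /andP[ij jn].
have xzi : x < z i by apply: xz; apply: leq_ltn_trans jn.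
case: (ltngtP i j) ij => // [ij _|<- //].
by rewrite (lt_trans xzi) // (separated_homo zsep) // ij.
Qed.

(** Exactly the i factors of index below i are negative. *)
Lemma prod_gap_sign z n i x : separated z n -> (i <= n)%N -> in_gap z n i x ->
  0 < (-1) ^+ i * \prod_(0 <= j < n) (z j - x).
Proof.
move=> zsep ilen gx; rewrite (big_cat_nat (n := i)) //= mulrA.
apply: mulr_gt0.
  rewrite big_mkord -[X in _ ^+ X]card_ord -prodrN.
  by apply: prodr_gt0 => j _; rewrite opprB subr_gt0 (in_gap_lt zsep ilen gx).
rewrite big_nat; apply: prodr_gt0 => j ijn.
by rewrite subr_gt0 (in_gap_gt zsep gx).
Qed.

(* [(z - x) / (z - q x)] increases with [z] as long as [x] and [q x] lie on the
   same side of [z]. *)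
Lemma prod_gap_cross_le z z' n i x : separated z n -> separated z' n ->
  (i <= n)%N -> in_gap z n i x -> in_gap z n i (q * x) ->
  in_gap z' n i x -> in_gap z' n i (q * x) -> 0 < x ->
  (forall j, (j < n)%N -> z' j <= z j) ->
  \prod_(0 <= j < n) (z' j - x) * \prod_(0 <= j < n) (z j - q * x) <=
  \prod_(0 <= j < n) (z j - x) * \prod_(0 <= j < n) (z' j - q * x).
Proof.
move=> zsep zsep' ilen gx gqx gx' gqx' x0 zle.
rewrite -!big_split /= !big_nat; apply: ler_prod => j /= jn.
apply/andP; split.
  case: (ltnP j i) => ij.
    apply: mulr_le0; rewrite subr_le0 ltW //.
      exact: in_gap_lt gx' ij.
    exact: in_gap_lt gqx ij.
  apply: mulr_ge0; rewrite subr_ge0 ltW //.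
    by apply: in_gap_gt zsep' gx' _; rewrite ij.
  by apply: in_gap_gt zsep gqx _; rewrite ij.
rewrite -subr_ge0.
have -> : (z j - x) * (z' j - q * x) - (z' j - x) * (z j - q * x)
  = (1 - q) * x * (z j - z' j) by ring.
by rewrite !mulr_ge0 ?subr_ge0 ?zle // ltW.
Qed.

(** * Factorization and signs in terms of the zeros *)

Definition zeros_separated n alpha beta :=
  size (rootsR (qMeixner q n alpha beta)) = n /\
  separated (qMeixner_zero q n alpha beta) n.

Lemma qMeixner_neq0 n alpha beta : qMeixner q n alpha beta != 0.
Proof.
apply/eqP => M0; have /eqP := qMeixner_at1 n alpha beta.
by rewrite M0 horner0 eq_sym oner_eq0.
Qed.

Lemma root_rootsR (p : {poly R}) x : p != 0 -> (x \in rootsR p) = root p x.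
Proof. by move=> p0; rewrite -(roots_on_rootsR p0) in_itv. Qed.

(** With n distinct roots, M_n is its leading coefficient times the product of the X - z_j; the
    value 1 at X = 1 eliminates that coefficient. *)
Lemma qMeixner_prod n alpha beta x : admissible alpha beta ->
  size (rootsR (qMeixner q n alpha beta)) = n ->
  (qMeixner q n alpha beta).[x]
    * \prod_(0 <= j < n) (qMeixner_zero q n alpha beta j - 1)
  = \prod_(0 <= j < n) (qMeixner_zero q n alpha beta j - x).
Proof.
move=> adm szr; set p := qMeixner q n alpha beta.
have rp : all (root p) (rootsR p).
  by apply/allP => y; rewrite root_rootsR ?qMeixner_neq0.
have up : poly.uniq_roots (rootsR p).
  by rewrite poly.uniq_rootsE (sorted_uniq lt_trans ltxx) // sorted_roots.
have sp : size p = (size (rootsR p)).+1 by rewrite size_qMeixner // szr.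
have hp y : p.[y] = lead_coef p * \prod_(0 <= j < n) (y - (rootsR p)`_j).
  rewrite {1}(all_roots_prod_XsubC sp rp up) hornerZ horner_prod (big_nth 0) szr.
  by under eq_bigr do rewrite hornerXsubC.
have neg y : \prod_(0 <= j < n) ((rootsR p)`_j - y)
   = (-1) ^+ n * \prod_(0 <= j < n) (y - (rootsR p)`_j).
  rewrite !big_mkord -[X in _ ^+ X]card_ord -prodrN.
  by apply: eq_bigr => j _; rewrite opprB.
have := hp 1; rewrite qMeixner_at1 => h1.
rewrite /qMeixner_zero -/p hp !neg; rewrite mulrCA mulrAC -h1.
by rewrite mul1r.
Qed.

Lemma separated_prod_gt0 z n : separated z n ->
  0 < \prod_(0 <= j < n) (z j - 1).
Proof.
case=> z_gt1 _; rewrite big_nat; apply: prodr_gt0 => j /andP[_ jn].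
by rewrite subr_gt0 z_gt1.
Qed.

Lemma qMeixner_sign n alpha beta i x : admissible alpha beta ->
  zeros_separated n alpha beta -> (i <= n)%N ->
  in_gap (qMeixner_zero q n alpha beta) n i x ->
  0 < (-1) ^+ i * (qMeixner q n alpha beta).[x].
Proof.
move=> adm [szr zsep] ilen gx; have := prod_gap_sign zsep ilen gx.
rewrite -qMeixner_prod // mulrA pmulr_lgt0 //.
exact: separated_prod_gt0.
Qed.

Lemma qMeixner_zero_root n alpha beta i :
  size (rootsR (qMeixner q n alpha beta)) = n -> (i < n)%N ->
  (qMeixner q n alpha beta).[qMeixner_zero q n alpha beta i] = 0.
Proof.
move=> szr ilt; apply/rootP; rewrite -root_rootsR ?qMeixner_neq0 //.
by apply: mem_nth; rewrite szr.
Qed.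

(** * Interlacing of the zeros at consecutive degrees *)

Definition bracketed (z : nat -> R) n i y :=
  [/\ 1 < y, forall j, i = j.+1 -> z j < q * y & (i < n)%N -> y < z i].

(** Adjacent brackets give y_j < z_j < q y_(j+1). *)
Lemma bracketed_separated z y n : separated z n ->
  (forall i, (i < n.+1)%N -> bracketed z n i (y i)) -> separated y n.+1.
Proof.
move=> zsep br; split=> [j jn|j jn]; first by case: (br j jn).
have [_ _ yz] := br j (ltnW jn); have [_ zy _] := br _ jn.
by rewrite (lt_trans (yz _)) // zy.
Qed.

(** Intermediate value theorem on a bracket: at each end either the sign is known directly or one
    term on the right of [qMeixner_rec] vanishes. *)
Lemma qMeixner_bracket n alpha beta i : admissible alpha beta ->
  zeros_separated n (alpha / q) (beta * q) -> (i <= n)%N ->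
  exists2 y, root (qMeixner q n.+1 alpha beta) y &
             bracketed (qMeixner_zero q n (alpha / q) (beta * q)) n i y.
Proof.
move=> adm zs ilen; have adm' := admissible_shift adm.
have [a0 b0 b1] := and3P adm.
have [szr zsep] := zs; have [z_gt1 zq] := zsep.
set z := qMeixner_zero q n (alpha / q) (beta * q) in zsep z_gt1 zq *.
set p := qMeixner q n.+1 alpha beta.
have sgn := qMeixner_sign adm' zs.
have rec x := qMeixner_rec n x adm.
(* Left end: 1 if i = 0, otherwise z_(i-1) / q, where the term in M_n(q X) vanishes. *)
have [l [l_ge1 sl zl lz]] : exists l, [/\ 1 <= l, 0 < (-1) ^+ i * p.[l],
    forall j, i = j.+1 -> z j <= q * l & (i < n)%N -> l < z i].
  case: i ilen => [|i] ilen.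
    exists 1; split=> //; first by rewrite qMeixner_at1 mulr1.
    exact: z_gt1.
  have zi_gt1 := z_gt1 i ilen.
  have zql : q * (z i / q) = z i by rewrite mulrC divfK ?lt0r_neq0.
  have zlt : z i < z i / q by rewrite ltr_pdivlMr // gtr_pMr // (lt_trans ltr01).
  have l_gt1 := lt_trans zi_gt1 zlt.
  have lz : (i.+1 < n)%N -> z i / q < z i.+1.
    by move=> i1n; rewrite ltr_pdivrMr // mulrC zq.
  exists (z i / q); split=> //; [exact: ltW| |by move=> j [<-]; rewrite zql].
  have := rec (z i / q); rewrite zql qMeixner_zero_root // mulr0 subr0.
  have := sgn i.+1 (z i / q) ilen.
  set l := z i / q; set u := (qMeixner _ _ _ _).[_] => h.
  have {}h : 0 < (-1) ^+ i.+1 * u by apply: h; split=> // j [<-].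
  have c1 : 0 < (1 - beta * q) * l by rewrite mulr_gt0 ?subr_gt0 // (lt_trans ltr01).
  rewrite -/p => e; rewrite -(pmulr_rgt0 _ c1) mulrCA e mulrCA.
  by rewrite mulr_gt0 // subr_gt0 (lt_trans b1).
(* Right end: z_i if i < n, where the term in M_n(X) vanishes; if i = n, a large point, where the
   leading coefficient imposes the sign (-1)^(n+1). *)
have [r [l_lt_r sr rz]] : exists r, [/\ l < r, (-1) ^+ i * p.[r] < 0
    & (i < n)%N -> r <= z i].
  case: (ltngtP i n) ilen => // [iltn _|iE _].
    exists (z i); split=> //; first exact: lz.
    have zi_gt1 := z_gt1 i iltn.
    have zi_gt0 := lt_trans ltr01 zi_gt1.
    have := rec (z i); rewrite -/z qMeixner_zero_root // mulr0 sub0r.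
    have := sgn i (q * z i) (ltnW iltn); rewrite -/p.
    set u := (qMeixner _ _ _ _).[_] => h.
    have {}h : 0 < (-1) ^+ i * u.
      apply: h; split=> [j jE|_]; last by rewrite gtr_pMl.
      by rewrite /= jE zq // -jE.
    have c1 : 0 < (1 - beta * q) * z i by rewrite mulr_gt0 ?subr_gt0.
    move=> e; rewrite -(pmulr_rlt0 _ c1) mulrCA e mulrN oppr_lt0 mulrCA.
    rewrite mulr_gt0 // !mulr_gt0 ?subr_gt0 //.
    by rewrite ltr_wpDr // divr_gt0.
  have := lead_coef_qMeixner n.+1 adm.
  rewrite -/p -lead_coefZ => /poly_pinfty_gt_lc[N HN].
  exists (Num.max N (l + 1)); split; last by [].
    by rewrite lt_max ltrDl ltr01 orbT.
  rewrite iE; have := HN (Num.max N (l + 1)); rewrite le_max lexx => /(_ isT).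
  rewrite hornerZ exprS mulN1r mulNr -oppr_gt0.
  apply: lt_le_trans.
  rewrite -mulN1r -exprS lead_coefZ.
  exact: (lead_coef_qMeixner n.+1 adm).
have ivt : p.[l] * p.[r] < 0.
  have : ((-1) ^+ i * p.[l]) * ((-1) ^+ i * p.[r]) < 0 by rewrite pmulr_rlt0.
  by rewrite mulrACA -exprMn mulrNN mulr1 expr1n mul1r.
have [y /[!in_itv]/andP[ly yr] ry] := poly_ivtoo (ltW l_lt_r) ivt.
exists y => //; split=> [|j jE|iltn]; first exact: le_lt_trans ly.
  by apply: le_lt_trans (zl j jE) _; rewrite ltr_pM2l.
exact: lt_le_trans (rz iltn).
Qed.

(** One root per bracket gives n+1 increasing roots; the degree being n+1, there are no others, and
    [rootsR] lists exactly these in this order. *)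
Lemma qMeixner_zerosS n alpha beta : admissible alpha beta ->
  zeros_separated n (alpha / q) (beta * q) ->
  zeros_separated n.+1 alpha beta /\
  forall i, (i < n.+1)%N -> bracketed (qMeixner_zero q n (alpha / q) (beta * q))
                              n i (qMeixner_zero q n.+1 alpha beta i).
Proof.
move=> adm zs.
have ex (i : 'I_n.+1) := qMeixner_bracket adm zs (ltn_ord i).
have [y ry br] := fin_all_exists2 ex.
set p := qMeixner q n.+1 alpha beta.
pose s := [seq y (inord j) | j <- iota 0 n.+1].
have snth j : (j < n.+1)%N -> s`_j = y (inord j).
  by move=> jn; rewrite (nth_map 0%N) ?size_iota // nth_iota.
have {}br j : (j < n.+1)%N ->
    bracketed (qMeixner_zero q n (alpha / q) (beta * q)) n j s`_j.
  by move=> jn; rewrite snth //; have := br (inord j); rewrite inordK.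
have ssep : separated (nth 0 s) n.+1 by apply: bracketed_separated br; case: zs.
have szs : size s = n.+1 by rewrite size_map size_iota.
have srt : sorted <%R s.
  apply/(sortedP 0) => j; rewrite szs => jn.
  by apply: separated_homo ssep _; rewrite ltnSn.
have rE : rootsR p = s.
  apply: lt_sorted_eq; [exact: sorted_roots|exact: srt|].
  have us := lt_sorted_uniq srt.
  have sub : {subset s <= rootsR p}.
    move=> x /mapP[j _ ->]; rewrite root_rootsR ?qMeixner_neq0 //; exact: ry.
  have [] // := uniq_min_size us sub.
    rewrite szs -ltnS -(size_qMeixner n.+1 adm).
    apply: max_poly_roots; [exact: qMeixner_neq0| |].
      by apply/allP => x; rewrite root_rootsR ?qMeixner_neq0.
    exact: (sorted_uniq lt_trans ltxx (sorted_roots _ _ _)).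
  by move=> _ e x; rewrite e.
by rewrite /zeros_separated /qMeixner_zero -/p rE.
Qed.

Lemma qMeixner_zeros n alpha beta : admissible alpha beta ->
  zeros_separated n alpha beta.
Proof.
elim: n alpha beta => [|n IHn] alpha beta adm.
  split; last by split.
  have /size1_polyC -> : (size (qMeixner q 0 alpha beta) <= 1)%N.
    by rewrite size_qMeixner.
  by rewrite rootsRC.
apply: (proj1 (qMeixner_zerosS adm _)).
exact/IHn/admissible_shift.
Qed.

(** * Monotonicity of the zeros in both parameters *)

Lemma qMeixner_zero_lt n alpha beta alpha' beta' i :
  admissible alpha beta -> admissible alpha' beta' ->
  alpha' <= alpha -> beta <= beta' -> (alpha' < alpha) || (beta < beta') ->
  (i < n)%N -> qMeixner_zero q n alpha' beta' i < qMeixner_zero q n alpha beta i.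
Proof.
elim: n alpha beta alpha' beta' i => // n IHn alpha beta alpha' beta' i adm adm'.
move=> lea leb ltab ilen.
have sadm := admissible_shift adm; have sadm' := admissible_shift adm'.
have [szr zsep] := qMeixner_zeros n sadm.
have [szr' zsep'] := qMeixner_zeros n sadm'.
have [[szy ysep] br] := qMeixner_zerosS adm (qMeixner_zeros n sadm).
have [[szy' ysep'] br'] := qMeixner_zerosS adm' (qMeixner_zeros n sadm').
(* The shift of parameters preserves all the comparisons, so one induction serves both
   parameters. *)
have zlt j : (j < n)%N -> qMeixner_zero q n (alpha' / q) (beta' * q) j <
                          qMeixner_zero q n (alpha / q) (beta * q) j.
  apply: IHn => //; first by rewrite ler_pM2r // invr_gt0.
    by rewrite ler_pM2r.
  by rewrite !ltr_pM2r // invr_gt0.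
have [y_gt1 zy yz] := br i ilen; have [y_gt1' zy' yz'] := br' i ilen.
have root_y : (qMeixner q n.+1 alpha beta).[qMeixner_zero q n.+1 alpha beta i] = 0.
  exact: qMeixner_zero_root.
have prodE x := qMeixner_prod x sadm szr.
have prodE' x := qMeixner_prod x sadm' szr'.
have rec := qMeixner_rec n (qMeixner_zero q n.+1 alpha beta i) adm.
have rec' := qMeixner_rec n (qMeixner_zero q n.+1 alpha beta i) adm'.
have sgn := qMeixner_sign adm' (conj szy' ysep') (ltnW ilen).
set y := qMeixner_zero q n.+1 alpha beta in y_gt1 zy yz root_y rec rec' ysep br szy *.
set y' := qMeixner_zero q n.+1 alpha' beta' in y_gt1' zy' yz' sgn ysep' br' szy' *.
set z := qMeixner_zero q n (alpha / q) (beta * q) in zsep zlt zy yz prodE br *.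
set z' := qMeixner_zero q n (alpha' / q) (beta' * q)
  in zsep' zlt zy' yz' prodE' br' *.
have y_gt0 : 0 < y i := lt_trans ltr01 y_gt1.
(* If z'_i <= y_i, the interlacing y'_i < z'_i concludes. Otherwise y_i and q y_i both lie in the
   i-th gap of z and of z', where the products can be compared. *)
have [/andP[iltn z'_le_y]|y_below] := boolP ((i < n)%N && (z' i <= y i)).
  exact: lt_le_trans (yz' iltn) z'_le_y.
have {}y_below : (i < n)%N -> y i < z' i.
  by move=> iltn; move: y_below; rewrite iltn /= -ltNge.
have ilen' : (i <= n)%N by [].
have qy_lt : q * y i < y i by rewrite gtr_pMl.
have gap w : (forall j, i = j.+1 -> w j < q * y i) ->
    ((i < n)%N -> y i < w i) -> in_gap w n i (y i) /\ in_gap w n i (q * y i).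
  move=> wy yw; split; split=> //.
    by move=> j jE; rewrite (lt_trans (wy j jE)).
  by move=> iltn; rewrite (lt_trans qy_lt) // yw.
have [gy gqy] := gap z zy yz.
have z'y j : i = j.+1 -> z' j < q * y i.
  by move=> jE; apply: lt_trans (zy j jE); apply: zlt; rewrite -ltnS -jE.
have [gy' gqy'] := gap z' z'y y_below.
have cross := prod_gap_cross_le zsep zsep' ilen' gy gqy gy' gqy' y_gt0
  (fun j jn => ltW (zlt j jn)).
have [f_gt0 g_gt0] := (qMeixner_sign sadm (conj szr zsep) ilen' gy,
                       qMeixner_sign sadm (conj szr zsep) ilen' gqy).
have g'_gt0 := qMeixner_sign sadm' (conj szr' zsep') ilen' gqy'.
have K_gt0 := separated_prod_gt0 zsep.
have K'_gt0 := separated_prod_gt0 zsep'.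
move: rec rec' cross f_gt0 g_gt0 g'_gt0; rewrite root_y mulr0.
rewrite -(prodE (y i)) -(prodE (q * y i)) -(prodE' (y i)) -(prodE' (q * y i)).
move: sgn K_gt0 K'_gt0.
(* The sign of [h] tells on which side of its zero y'_i the point y_i lies. *)
set h := (qMeixner q n.+1 alpha' beta').[y i].
set K := \prod_(0 <= j < n) (z j - 1); set K' := \prod_(0 <= j < n) (z' j - 1).
set m := (qMeixner q n (alpha / q) (beta * q)).[y i].
set mq := (qMeixner q n (alpha / q) (beta * q)).[q * y i].
set m' := (qMeixner q n (alpha' / q) (beta' * q)).[y i].
set mq' := (qMeixner q n (alpha' / q) (beta' * q)).[q * y i].
set sg := (-1) ^+ i => sgn K_gt0 K'_gt0 rec rec' cross f_gt0 g_gt0 g'_gt0.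
have sgK : sg * sg = 1 by rewrite -exprMn mulrNN mulr1 expr1n.
(* By [qMeixner_prod] the products are values of M_n times [K] or [K']; the positive factor K K'
   cancels. *)
have {}cross : m' * mq <= m * mq'.
  rewrite -(ler_pM2r (mulr_gt0 K_gt0 K'_gt0)).
  by rewrite [K * K']mulrC mulrACA [K' * K]mulrC [leRHS]mulrACA.
have [a0 b0 b1] := and3P adm; have [a0' b0' b1'] := and3P adm'.
have B_lt : y i / alpha + beta < y i / alpha' + beta'.
  case/orP: ltab => [lta|ltb].
    by rewrite ltr_leD // ltr_pM2l // ltf_pV2.
  by rewrite ler_ltD // ler_pM2l // lef_pV2.
(* With [A := y i - beta q] and [B := q (y i - 1) (y i / alpha + beta)], the
   recurrence at the zero [y i] gives [A m = B mq], and, up to the sign [sg],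
   [A' m' mq <= A' m mq' <= A m mq' = B mq mq' < B' mq mq']. *)
have h_lt0 : sg * h < 0.
  have c_gt0 : 0 < (1 - beta' * q) * y i by rewrite mulr_gt0 ?subr_gt0.
  rewrite -(pmulr_rlt0 _ c_gt0) mulrCA rec' mulrBr subr_lt0.
  rewrite -(ltr_pM2r g_gt0).
  have A'_gt0 : 0 < y i - beta' * q by rewrite subr_gt0 (lt_trans b1').
  have A'_le : y i - beta' * q <= y i - beta * q by rewrite lerB // ler_pM2r.
  have e1 : (sg * ((y i - beta' * q) * m')) * (sg * mq) =
    (y i - beta' * q) * (m' * mq) by rewrite -(mul1r (_ * (m' * _))) -sgK; ring.
  apply: (@le_lt_trans _ _ ((y i - beta' * q) * (m * mq'))).
    by rewrite e1 ler_pM2l.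
  have mmq_gt0 : 0 < m * mq'.
    by have := mulr_gt0 f_gt0 g'_gt0; rewrite mulrACA sgK mul1r.
  apply: (@le_lt_trans _ _ ((y i - beta * q) * (m * mq'))).
    by rewrite ler_pM2r.
  have -> : (y i - beta * q) * (m * mq') =
      (sg * mq) * (sg * mq') * (q * (y i - 1)) * (y i / alpha + beta).
    move/esym/eqP: rec; rewrite subr_eq0 => /eqP rec; rewrite [LHS]mulrA rec.
    by rewrite [sg * mq * _]mulrACA sgK mul1r; ring.
  have -> : sg * (q * (y i - 1) * (y i / alpha' + beta') * mq') * (sg * mq) =
      (sg * mq) * (sg * mq') * (q * (y i - 1)) * (y i / alpha' + beta').
    by ring.
  rewrite ltr_pM2l //; apply: mulr_gt0; first exact: mulr_gt0.
  by rewrite mulr_gt0 ?subr_gt0.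
rewrite ltNge; apply/negP; rewrite le_eqVlt => /predU1P[yE|y_lt].
  by move: h_lt0; rewrite /h yE qMeixner_zero_root // mulr0 ltxx.
(* If y_i < y'_i, then y'_(i-1) < z'_(i-1) < q y_i < y_i puts y_i in the i-th gap of y', where the
   sign contradicts [h_lt0]. *)
have : 0 < sg * h.
  apply: sgn; split=> // j jE; apply: lt_trans qy_lt.
  have jn : (j < n)%N by rewrite -ltnS -jE.
  have [_ _ /(_ jn) y'z'] := br' j (ltnW jn).
  exact: lt_trans y'z' (z'y j jE).
by rewrite ltNge ltW.
Qed.

End QMeixner.

Theorem proposition3p7 (R : realType) (q : R) (n : nat)
    (hq0 : 0 < q) (hq1 : q < 1) (hn : (1 <= n)%N) (k : 'I_n) :
  (forall beta : R, 0 <= beta < q^-1 ->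
     {in `]0, +oo[ &, {homo (fun alpha : R => qMeixner_zero q n alpha beta k)
                        : a1 a2 / a1 < a2 >-> a1 < a2}}) /\
  (forall alpha : R, 0 < alpha ->
     {in `[0, q^-1[ &, {homo (fun beta : R => qMeixner_zero q n alpha beta k)
                         : b1 b2 / b1 < b2 >-> b2 < b1}}).
Proof.
have adm alpha beta : 0 < alpha -> 0 <= beta < q^-1 -> admissible q alpha beta.
  by move=> a0 /andP[b0 b1]; rewrite /admissible a0 b0 -ltr_pdivlMr // div1r.
split=> [beta hb a1 a2|alpha ha b1 b2]; rewrite !in_itv /= ?andbT => h1 h2 lt12.
  apply: qMeixner_zero_lt => //; [exact: adm|exact: adm|exact: ltW|].
  by rewrite lt12.
apply: qMeixner_zero_lt => //; [exact: adm|exact: adm|exact: ltW|].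
by rewrite lt12 orbT.
Qed.
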